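(* Let $(\kappa,k_1,k_2)\in\mathcal{L}_1^1$ and $n\in\mathbb{N}$. For every function $f\in C_{-1,(k_1,k_2)}^{n-1}(0,+\infty)$, its $n$-fold sequential 1st level GFD $({}_{1L}\mathbb{D}_{(k_1,k_2)}^{<n>}f)(t)$ exists in the usual sense and coincides with the $n$-fold sequential 1st level AGFD, denoted ${}_{1L}\mathbb{D}_{(k_1,k_2)}^{<n>}\,f$ (without argument): $$({}_{1L}\mathbb{D}_{(k_1,k_2)}^{<n>}f)(t)={}_{1L}\mathbb{D}_{(k_1,k_2)}^{<n>}\,f=S_\kappa^n\cdot f-\sum_{j=0}^{n-1}(\mathbb{I}_{(k_2)}\,{}_{1L}\mathbb{D}_{(k_1,k_2)}^{<j>}f)(0)\,S_\kappa^{n-j-1}\cdot k_1(t),$$ provided all functions from the ring $\mathcal{R}_{-1}$ in this formula are interpreted as elements of the field $\mathcal{F}_{-1}$.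
   Context: $C_{-1}(0,+\infty)$ is the space of functions $f$ on $(0,+\infty)$ of the form $f(t)=t^{p}f_1(t)$, $t>0$, with some $p>-1$ and $f_1\in C[0,+\infty)$. The symbol $*$ denotes the Laplace convolution $(f*g)(t)=\int_0^t f(t-\tau)g(\tau)\,d\tau$, $t>0$; for $n\in\mathbb{N}$, $\kappa^{<n>}$ is the convolution power $\kappa*\cdots*\kappa$ ($n$ factors), $\kappa^{<1>}=\kappa$. $\mathcal{L}_1^1$ is the set of triples $(\kappa,k_1,k_2)$ of real-valued functions belonging to $C_{-1}(0,+\infty)$ with $(\kappa*k_1*k_2)(t)=1$ for all $t>0$ (1st level kernels). For $k\in C_{-1}(0,+\infty)$: $(\mathbb{I}_{(k)}f)(t)=(k*f)(t)$ (general fractional integral, GFI), $(\mathbb{D}_{(k)}f)(t)=\frac{d}{dt}(\mathbb{I}_{(k)}f)(t)$. The 1st level general fractional derivative (1st level GFD) is $({}_{1L}\mathbb{D}_{(k_1,k_2)}f)(t)=\left(\mathbb{I}_{(k_1)}\frac{d}{dt}\mathbb{I}_{(k_2)}f\right)(t)$, and the $n$-fold sequential 1st level GFD ${}_{1L}\mathbb{D}_{(k_1,k_2)}^{<n>}$ is its $n$-fold composition with itself (the identity for $n=0$). For $m\in\mathbb{N}\cup\{0\}$, $$C_{-1,(k_1,k_2)}^{m}(0,+\infty)=\{f:\ {}_{1L}\mathbb{D}_{(k_1,k_2)}^{<j>}f\in C_{-1}(0,+\infty)\ \text{and}\ \mathbb{D}_{(k_2)}\,{}_{1L}\mathbb{D}_{(k_1,k_2)}^{<j>}f\in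 C_{-1}(0,+\infty),\ j=0,\dots,m\}.$$ The value $(\mathbb{I}_{(k_2)}g)(0)$ is the value at $0$ of the continuous extension of $\mathbb{I}_{(k_2)}g$ to $[0,+\infty)$, i.e. $\lim_{t\to0+}(\mathbb{I}_{(k_2)}g)(t)$. $\mathcal{R}_{-1}=(C_{-1}(0,+\infty),+,* )$ is a commutative ring without unity and without divisors of zero. $\mathcal{F}_{-1}$ is its field of convolution quotients: equivalence classes $\frac{f}{g}$ of pairs $(f,g)$ with $f\in C_{-1}(0,+\infty)$, $g\in C_{-1}(0,+\infty)\setminus\{0\}$, under $(f_1,g_1)\sim(f_2,g_2)\Leftrightarrow f_1*g_2=f_2*g_1$, with the usual fraction addition $\frac{f_1}{g_1}+\frac{f_2}{g_2}=\frac{f_1*g_2+f_2*g_1}{g_1*g_2}$ and multiplication $\frac{f_1}{g_1}\cdot\frac{f_2}{g_2}=\frac{f_1*f_2}{g_1*g_2}$, and with scalar multiplication $\lambda\frac{f}{g}=\frac{\lambda f}{g}$. The ring $\mathcal{R}_{-1}$ is embedded in $\mathcal{F}_{-1}$ by $f\mapsto\frac{f*\kappa}{\kappa}$. $S_\kappa=\frac{\kappa}{\kappa^{<2>}}\in\mathcal{F}_{-1}$ (the multiplicative inverse of $\kappa$ in $\mathcal{F}_{-1}$); $S_\kappa^n$ is its $n$-th power in $\mathcal{F}_{-1}$, and $S_\kappa^0=I$ is the unity of $\mathcal{F}_{-1}$. The $n$-fold sequential 1st level algebraic general fractional derivative (AGFD) of $f$ is the element of $\mathcal{F}_{-1}$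 given by $${}_{1L}\mathbb{D}_{(k_1,k_2)}^{<n>}\,f:=S_\kappa^n\cdot f-S_\kappa^n\cdot(P_{1L}^{<n>}f),\qquad (P_{1L}^{<n>}f)(t)=\sum_{j=0}^{n-1}(\mathbb{I}_{(k_2)}\,{}_{1L}\mathbb{D}_{(k_1,k_2)}^{<j>}f)(0)\,(\kappa^{<j+1>}*k_1)(t),$$ where $f$ and $P_{1L}^{<n>}f$ are interpreted as elements of $\mathcal{F}_{-1}$. *)

(* Defs.v *)
(* A function on (0,+oo) is represented by a function
   R -> R; its values at t <= 0 are irrelevant, and equality of two such
   functions means equality at every t > 0. *)
From mathcomp Require Import all_boot all_order all_algebra.
From mathcomp Require Import all_classical all_reals all_analysis.

Set Implicit Arguments.
Unset Strict Implicit.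
Unset Printing Implicit Defensive.

Import Order.TTheory GRing.Theory Num.Theory.
Import numFieldNormedType.Exports.

Local Open Scope classical_set_scope.
Local Open Scope ring_scope.

Section Operators.
Context {R : realType}.
Implicit Types (f g k kappa : R -> R) (n m j : nat) (t : R).

(* C_{-1}(0,+oo) *)
Definition Cm1 f : Prop :=
  exists (p : R) (f1 : R -> R),
    [/\ -1 < p, {within `[0, +oo[, continuous f1}
      & forall t, 0 < t -> f t = t `^ p * f1 t].

Definition conv f g : R -> R :=
  fun t => \int[@lebesgue_measure R]_(tau in `]0, t[) (f (t - tau) * g tau).

(* The integral in [conv f g t] converges absolutely (both factors may be
   singular at 0); otherwise [conv f g t] is a default value. *)
Definition conv_exists f g t : Prop :=
  (@lebesgue_measure R).-integrable `]0, t[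
    (fun tau => (f (t - tau) * g tau)%:E).

(* kappa^{<n>} for n >= 1; the value at n = 0 is a default. *)
Definition conv_pow kappa n : R -> R := iter n.-1 (conv kappa) kappa.

Definition L11 kappa k1 k2 : Prop :=
  [/\ Cm1 kappa, Cm1 k1, Cm1 k2
    & forall t, 0 < t -> conv (conv kappa k1) k2 t = 1].

Definition GFI k f : R -> R := conv k f.

Definition GFD k f : R -> R := (GFI k f)^`()%classic.

(* [^`()] is total, so that the existence of the derivative is stated apart. *)
Definition GFD_exists k f : Prop :=
  forall t, 0 < t -> conv_exists k f t /\ derivable (GFI k f) t 1.

Definition GFD1 k1 k2 f : R -> R := GFI k1 (GFD k2 f).

Definition GFD1_exists k1 k2 f : Prop :=
  GFD_exists k2 f /\ forall t, 0 < t -> conv_exists k1 (GFD k2 f) t.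

Definition GFD1_seq k1 k2 n f : R -> R := iter n (GFD1 k1 k2) f.

Definition GFD1_seq_exists k1 k2 n f : Prop :=
  forall j, (j < n)%N -> GFD1_exists k1 k2 (GFD1_seq k1 k2 j f).

(* C_{-1,(k1,k2)}^m(0,+oo).  Since GFD1_seq j.+1 f = k1 * D_(k2) (GFD1_seq j f),
   the clauses for j make the function of the clause for j.+1 exist. *)
Definition Cm1_space k1 k2 m f : Prop :=
  forall j, (j <= m)%N ->
    [/\ Cm1 (GFD1_seq k1 k2 j f),
        GFD_exists k2 (GFD1_seq k1 k2 j f)
      & Cm1 (GFD k2 (GFD1_seq k1 k2 j f))].

(* The value at 0 of the continuous extension of I_(k) g to [0,+oo). *)
Definition GFI0 k g : R := lim (GFI k g t @[t --> 0^'+]).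

Definition P1L kappa k1 k2 n f : R -> R := fun t =>
  \sum_(j < n) GFI0 k2 (GFD1_seq k1 k2 j f) * conv (conv_pow kappa j.+1) k1 t.

End Operators.

Section ConvolutionQuotients.
Context {R : realType}.

Definition ring_pair : Type := ((R -> R) * (R -> R))%type.

Implicit Types (p q r : ring_pair) (f g k kappa : R -> R) (lambda : R).

Definition is_fraction p : Prop :=
  [/\ Cm1 p.1, Cm1 p.2 & exists t, 0 < t /\ p.2 t != 0].

Definition frac_equiv p q : Prop :=
  forall t, 0 < t -> conv p.1 q.2 t = conv q.1 p.2 t.

(* Elements of F_{-1} are equivalence classes, i.e. sets of pairs, and
   equality in F_{-1} is equality of classes. *)
Definition quotients : Type := set ring_pair.

Definition frac f g : quotients :=
  [set r | is_fraction r /\ frac_equiv r (f, g)].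

(* The operation on classes induced by an operation on pairs: the class of the
   fractions equivalent to [op p q] for every choice of the representatives
   [p] and [q].  For the operations below [op] respects [frac_equiv], because
   [conv] has no zero divisors, so that any single choice gives this class. *)
Definition lift1 (op : ring_pair -> ring_pair) (c : quotients) : quotients :=
  [set r | is_fraction r /\ forall p, c p -> frac_equiv r (op p)].

Definition lift2 (op : ring_pair -> ring_pair -> ring_pair)
    (c d : quotients) : quotients :=
  [set r | is_fraction r /\ forall p q, c p -> d q -> frac_equiv r (op p q)].

Definition addF : quotients -> quotients -> quotients :=
  lift2 (fun p q => (fun t => conv p.1 q.2 t + conv q.1 p.2 t, conv p.2 q.2)).

Definition mulF : quotients -> quotients -> quotients :=
  lift2 (fun p q => (conv p.1 q.1, conv p.2 q.2)).

Definition scaleF lambda : quotients -> quotients :=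
  lift1 (fun p => (fun t => lambda * p.1 t, p.2)).

Definition subF (c d : quotients) : quotients := addF c (scaleF (-1) d).

(* The classes of 0/g and g/g, for any nonzero g. *)
Definition zeroF : quotients :=
  [set r | is_fraction r /\ forall t, 0 < t -> r.1 t = 0].

Definition oneF : quotients :=
  [set r | is_fraction r /\ forall t, 0 < t -> r.1 t = r.2 t].

Definition powF (c : quotients) (n : nat) : quotients := iter n (mulF c) oneF.

Definition embF kappa f : quotients := frac (conv f kappa) kappa.

Definition SF kappa : quotients := frac kappa (conv_pow kappa 2).

Definition AGFD1 kappa k1 k2 (n : nat) f : quotients :=
  subF (mulF (powF (SF kappa) n) (embF kappa f))
       (mulF (powF (SF kappa) n) (embF kappa (P1L kappa k1 k2 n f))).

End ConvolutionQuotients.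

Arguments ring_pair : clear implicits.
Arguments quotients : clear implicits.

(* Main.v *)
(* Write k for kappa and g_j for the j-fold sequential derivative of f.  Since
   k2 * g_j has its derivative in C_{-1}, it equals c_j 1 + 1 * (k2 * g_j)' with
   c_j its limit at 0+.  Substituting 1 = k * k1 * k2 and cancelling k2 gives
   g_j = c_j (k * k1) + k * g_{j+1}, hence
   f = P_{1L}^{<n>} f + k^{<n>} * g_n; multiplying by S_k^n is the theorem.

   Titchmarsh's theorem is not needed: every class that occurs has an explicit
   representative whose denominator divides the function 1 for the convolution,
   and such a function is cancellable because 1 * g = 0 implies g = 0 by
   differentiation. *)
Require Import Defs.
From HB Require Import structures.
From mathcomp Require Import all_boot all_order all_algebra.
From mathcomp Require Import all_classical all_reals all_analysis.
From mathcomp Require Import measurable_realfun ring lra zify.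

Set Implicit Arguments.
Unset Strict Implicit.
Unset Printing Implicit Defensive.

Import Order.TTheory GRing.Theory Num.Theory.
Import numFieldNormedType.Exports.

Local Open Scope classical_set_scope.
Local Open Scope ring_scope.

(* [conv] and [frac] also exist in the libraries. *)
Local Notation conv := Defs.conv.
Local Notation frac := Defs.frac.

(** * Affine changes of variable *)

(** Once convolution is the product of a commutative ring with unity, the algebra reduces to
    polynomial identities. The ring R_{-1} has no unity and functions matter only for t > 0, so the
    identities are proved in its unitization, on functions extended by 0; there kappa^0, scalars and
    differences are ring expressions. The analytic cost is closure of C_{-1} under convolution and
    associativity, with both factors possibly singular at 0. After tau = t u the singularities sit
    at opposite ends of ]0,1[ and the integrand is dominated uniformly for bounded t. The changes of
    variable serve this substitution, commutativity and Fubini. Classes in F_{-1} quantify over all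
    representatives, whose denominators are only known to be nonzero; hence every comparison cancels
    the denominator of an explicit representative, never that of an arbitrary one. *)

Section affine_change_of_variable.
Context {R : realType}.
Local Notation mu := (@lebesgue_measure R).
Variables (a b : R).
Hypothesis a0 : a != 0.

Let phi : measurableTypeR R -> measurableTypeR R := fun x => a * x + b.

Lemma measurable_affine : measurable_fun [set: R] (fun x : R => a * x + b).
Proof. by apply: measurable_funD => //; apply: measurable_funM. Qed.

Let mphi : measurable_fun setT phi. Proof. exact: measurable_affine. Qed.

(** Uniqueness of Lebesgue measure: the scaled pushforward agrees with it on the intervals ]c, d].
    For a < 0 the preimage of such an interval is closed on the left instead of the right. *)
Lemma lebesgue_measure_affine (A : set R) : measurable A ->
  mu A = (`|a|%R%:E * mu ((fun x : R => (a * x + b)%R) @^-1` A))%E.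
Proof.
move=> mA.
have na0 : 0 <= `|a| by [].
have := @lebesgue_measure_unique R
  (mscale (NngNum na0) (pushforward mu phi : {measure set _ -> \bar R})).
apply => // _ [[c d]] _ <-.
change (mu `]c, d]%classic = (`|a|%R%:E * mu (phi @^-1` `]c, d]%classic))%E).
have -> : phi @^-1` `]c, d]%classic =
    if 0 < a then `](c - b) / a, (d - b) / a]%classic
    else `[(d - b) / a, (c - b) / a[%classic.
  apply/seteqP; split => x; case: ltP => ap; rewrite /phi/= !in_itv/=.
  - by rewrite ltr_pdivrMr// ler_pdivlMr// ltrBlDr lerBrDr mulrC.
  - have {}ap : a < 0 by rewrite lt_neqAle a0.
    by rewrite ler_ndivrMr// ltr_ndivlMr// ltrBlDr lerBrDr mulrC andbC.
  - by rewrite ltr_pdivrMr// ler_pdivlMr// ltrBlDr lerBrDr mulrC.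
  - have {}ap : a < 0 by rewrite lt_neqAle a0.
    by rewrite ler_ndivrMr// ltr_ndivlMr// ltrBlDr lerBrDr mulrC andbC.
case: ltP => ap; rewrite !lebesgue_measure_itv/= !lte_fin.
  rewrite ltr_pM2r ?invr_gt0// ltrD2r gtr0_norm//.
  by case: ifP; rewrite ?mule0// => _; rewrite -!EFinD -EFinM; congr EFin; field.
have {}ap : a < 0 by rewrite lt_neqAle a0.
rewrite ltr_nM2r ?invr_lt0// ltrD2r ltr0_norm//.
by case: ifP; rewrite ?mule0// => _; rewrite -!EFinD -EFinM; congr EFin; field.
Qed.

Lemma ge0_integral_affine (f : R -> \bar R) : measurable_fun setT f ->
  (forall x, 0 <= f x)%E ->
  (\int[mu]_x f x = `|a|%R%:E * \int[mu]_x f (a * x + b)%R)%E.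
Proof.
move=> mf f0.
have na0 : 0 <= `|a| by [].
pose nu := mscale (NngNum na0) (pushforward mu phi : {measure set _ -> \bar R}).
transitivity (\int[nu mphi]_x f x)%E.
  by apply: eq_measure_integral => A mA _; exact: lebesgue_measure_affine.
rewrite ge0_integral_mscale//; congr (_ * _)%E.
by rewrite ge0_integral_pushforward.
Qed.

End affine_change_of_variable.

(** * Reflection, translation and scaling of integrals over the line *)

Section integral_lemmas.
Context {R : realType}.
Local Notation mu := (@lebesgue_measure R).

Lemma integral_reflect (t : R) (f : R -> \bar R) : measurable_fun setT f ->
  (\int[mu]_x f (t - x)%R = \int[mu]_x f x)%E.
Proof.
move=> mf.
have E (g : R -> \bar R) : measurable_fun setT g -> (forall x, 0 <= g x)%E ->
    (\int[mu]_x g (t - x)%R = \int[mu]_x g x)%E.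
  move=> mg g0; rewrite (@ge0_integral_affine R (-1) t _ g)//.
  by rewrite normrN1 mul1e; apply: eq_integral => x _; rewrite mulN1r addrC.
rewrite integralE [RHS]integralE; congr (_ - _)%E.
  rewrite -[RHS]E//; last exact: measurable_funepos.
  by apply: eq_integral => x _; rewrite !funeposE.
rewrite -[RHS]E//; last exact: measurable_funeneg.
by apply: eq_integral => x _; rewrite !funenegE.
Qed.

Lemma integral_translate (t : R) (f : R -> \bar R) : measurable_fun setT f ->
  (\int[mu]_x f (x - t)%R = \int[mu]_x f x)%E.
Proof.
(* A translation is the composite of two reflections: x - t = 0 - (t - x). *)
move=> mf; rewrite -(@integral_reflect 0 f)//.
rewrite -(@integral_reflect t (fun x => f (0 - x)%R)).
  by apply: eq_integral => x _; congr f; rewrite sub0r opprB.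
by apply: measurableT_comp => //; apply: measurable_funB.
Qed.

(** Integrability is transported from the rescaled function to f, because for a convolution the
    domination is available only after the substitution. *)
Lemma Rintegral_scale (t : R) (f : R -> R) : 0 < t -> measurable_fun setT f ->
  mu.-integrable setT (fun x => (f (t * x))%:E) ->
  mu.-integrable setT (EFin \o f) /\
  \int[mu]_x f x = t * \int[mu]_x f (t * x).
Proof.
move=> t0 mf fi.
have E (g : R -> \bar R) : measurable_fun setT g -> (forall x, 0 <= g x)%E ->
    (\int[mu]_x g x = t%:E * \int[mu]_x g (t * x)%R)%E.
  move=> mg g0; rewrite (@ge0_integral_affine R t 0 _ g) ?gt_eqF// gtr0_norm//.
  by congr (_ * _)%E; apply: eq_integral => x _; rewrite addr0.
have mEf : measurable_fun setT (EFin \o f) by apply/measurable_EFinP.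
have fi' : mu.-integrable setT (EFin \o f).
  apply/integrableP; split => //.
  rewrite E//; last exact: measurableT_comp.
  by move/integrableP : fi => [_ fi]; rewrite lte_mul_pinfty// lee_fin ltW.
split => //; apply: EFin_inj; rewrite EFinM !fineK; try exact: integrable_fin_num.
rewrite integralE E//; last exact: measurable_funepos.
rewrite (E (fun x => (EFin \o f)^\- x)%E)//; last exact: measurable_funeneg.
pose h x := (f (t * x))%:E.
have -> : (\int[mu]_x (EFin \o f)^\+ (t * x)%R = \int[mu]_x h^\+ x)%E.
  by apply: eq_integral => x _; rewrite !funeposE.
have -> : (\int[mu]_x (EFin \o f)^\- (t * x)%R = \int[mu]_x h^\- x)%E.
  by apply: eq_integral => x _; rewrite !funenegE.
by rewrite -muleBr// -?integralE// integrable_add_def.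
Qed.

End integral_lemmas.

(** * Power singularities *)

Section power_singularity.
Context {R : realType}.
Local Notation mu := (@lebesgue_measure R).

Lemma continuous_powR (p x : R) : 0 < x -> {for x, continuous (fun y : R => y `^ p)}.
Proof.
move=> x0; apply: differentiable_continuous; apply/derivable1_diffP.
by apply: derivable_powR; rewrite in_itv/= x0.
Qed.

Lemma within_continuous_powR (p a b : R) : 0 < a ->
  {within `[a, b], continuous (fun y : R => y `^ p)}.
Proof.
move=> a0; apply: continuous_in_subspaceT => x; rewrite inE/= in_itv/=.
by move=> /andP[ax _]; apply: continuous_powR; exact: lt_le_trans ax.
Qed.

(** The bound does not depend on a, so it survives the exhaustion of ]0, 1] by compact intervals. *)
Lemma integral_powR_le (q a : R) : -1 < q -> 0 < a < 1 ->
  (\int[mu]_(x in `[a, 1%R]) (x `^ q)%:E <= (q + 1)^-1%:E)%E.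
Proof.
move=> q1 /andP[a0 a1]; have q0 : 0 < q + 1 by lra.
pose F x := (q + 1)^-1 * x `^ (q + 1).
have dF (x : R) : 0 < x -> is_derive x 1 F (x `^ q).
  move=> x0; have -> : x `^ q = (q + 1)^-1 *: ((q + 1) * x `^ (q + 1 - 1)).
    by rewrite addrK /GRing.scale/= mulKf// gt_eqF.
  by apply: is_deriveZ; exact: is_derive1_powR.
have cF (x : R) : 0 < x -> {for x, continuous F}.
  move=> x0; apply: differentiable_continuous; apply/derivable1_diffP.
  by have [] := dF _ x0.
rewrite (@continuous_FTC2 _ _ F)//.
- rewrite -EFinB lee_fin /F powR1 mulr1 gerBl.
  by rewrite mulr_ge0 ?powR_ge0// invr_ge0 ltW.
- exact: within_continuous_powR.
- split.
  + move=> x; rewrite in_itv/= => /andP[ax _].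
    by have [] := dF x (lt_trans a0 ax).
  + by apply: cvg_at_right_filter; apply: cF.
  + by apply: cvg_at_left_filter; apply: cF.
- move=> x; rewrite in_itv/= => /andP[ax _].
  by rewrite derive1E; have [_ ->] := dF x (lt_trans a0 ax).
Qed.

Lemma integrable_powR (q : R) : -1 < q ->
  mu.-integrable `]0, 1[ (fun x => (x `^ q)%:E).
Proof.
move=> q1.
have mq D : measurable_fun D (fun x : R => (x `^ q)%:E).
  by apply: measurable_funTS; apply/measurable_EFinP; exact: measurable_powR.
have pos (x : R) : (0 <= (x `^ q)%:E)%E by rewrite lee_fin powR_ge0.
apply: (@integrableS _ _ R mu `]0%R, 1%R]%classic) => //.
  by apply: subset_itvl; rewrite bnd_simp.
apply/integrableP; split; first exact: mq.
under eq_integral do rewrite gee0_abs//.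
(* Starting at 1/2 keeps the left end below 1, as [integral_powR_le] requires. *)
pose F (n : nat) : set R := `[n.+2%:R^-1, 1]%classic.
have -> : `]0, 1]%classic = \bigcup_n F n.
  apply/seteqP; split => x; rewrite /F/= ?in_itv/=.
    move=> /andP[x0 x1]; have [n _ nx] := @near_infty_natSinv_lt R (PosNum x0).
    exists n => //; rewrite set_itvE/= x1 andbT ltW//; exact: (nx n.+1 (leqnSn n)).
  move=> [n _]; rewrite set_itvE/= => /andP[nx ->]; rewrite andbT.
  by apply: lt_le_trans nx; rewrite invr_gt0.
have cF : (\int[mu]_(x in F n) (x `^ q)%:E @[n --> \oo] -->
    \int[mu]_(x in \bigcup_n F n) (x `^ q)%:E)%E.
  apply: ge0_nondecreasing_set_cvg_integral => //; last 2 first.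
  - by move=> n; exact: measurable_itv.
  - by move=> n; exact: mq.
  move=> m n mn; apply/subsetPset; apply: subset_itvr; rewrite bnd_simp.
  by rewrite lef_pV2 ?posrE// ler_nat.
suff H : (\int[mu]_(x in \bigcup_n F n) (x `^ q)%:E <= (q + 1)^-1%:E)%E.
  by rewrite (le_lt_trans H)// ltry.
rewrite -(cvg_lim _ cF)//; apply: lime_le; first by apply/cvg_ex; eexists; exact: cF.
near=> n; apply: integral_powR_le => //.
by rewrite invr_gt0 ltr0n/= invf_lt1// ltr1n.
Unshelve. all: by end_near. Qed.

Lemma integrable_reflect (t : R) (f : R -> \bar R) :
  mu.-integrable setT f -> mu.-integrable setT (fun x => f (t - x)).
Proof.
move=> /integrableP[mf fi]; apply/integrableP; split.
  by apply: measurableT_comp => //; apply: measurable_funB.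
rewrite (@integral_reflect R t (fun x => `|f x|%E))//.
exact: measurableT_comp.
Qed.

Lemma integrable_powR_onem (q : R) : -1 < q ->
  mu.-integrable `]0, 1[ (fun x => ((1 - x) `^ q)%:E).
Proof.
move=> /integrable_powR iq; apply/integrable_mkcond => //.
have {}iq := (integrable_mkcond (mu := mu) (D := `]0%R, 1%R[%classic)
  (fun x : R => (x `^ q)%:E) (measurable_itv _)).1 iq.
move: (@integrable_reflect 1 _ iq).
congr (mu.-integrable setT _); apply/funext => x.
rewrite !patchE; have -> : (1 - x \in `]0, 1[%classic) = (x \in `]0, 1[%classic).
  by apply/idP/idP; rewrite !inE/= !in_itv/=; lra.
by [].
Qed.

Lemma beta_bound (p q u : R) : -1 < p -> -1 < q -> 0 < u < 1 ->
  (1 - u) `^ p * u `^ q <= 2 * ((1 - u) `^ p + u `^ q).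
Proof.
move=> p1 q1 /andP[u0 u1].
(* a^r <= a^-1 <= 2, applied to the larger one of u and 1 - u. *)
have H r a : -1 < r -> 2^-1 <= a < 1 -> a `^ r <= 2.
  move=> r1 /andP[a2 a1]; have a0 : 0 < a by lra.
  apply: (@le_trans _ _ (a `^ (-1))).
    by apply: ger_powR; [rewrite a0 ltW|exact: ltW].
  rewrite powR_inv1; last exact: ltW.
  by rewrite invf_ple ?posrE.
rewrite mulrDr; have [u2|u2] := lerP u 2^-1.
  apply: (@le_trans _ _ (2 * u `^ q)).
    by rewrite ler_wpM2r ?powR_ge0// H//; lra.
  by rewrite lerDr mulr_ge0// powR_ge0.
apply: (@le_trans _ _ (2 * (1 - u) `^ p)).
  by rewrite mulrC ler_wpM2r ?powR_ge0// H//; lra.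
by rewrite lerDl mulr_ge0// powR_ge0.
Qed.

End power_singularity.

(** * Functions of C_{-1} extended by 0 to the negative half-line *)

Section causal_functions.
Context {R : realType}.
Local Notation mu := (@lebesgue_measure R).
Implicit Types (f g : R -> R) (p q t x : R).

(** Extension by 0 turns convolution integrals into integrals over the whole line, and equality at
    every t > 0 into equality of functions. *)
Definition causal f : R -> R := fun t => if 0 < t then f t else 0.

Lemma causal_pos f t : 0 < t -> causal f t = f t.
Proof. by rewrite /causal => ->. Qed.

Lemma causal_eq f g : (forall t, 0 < t -> f t = g t) -> causal f = causal g.
Proof. by move=> fg; apply/funext => t; rewrite /causal; case: ifPn => // /fg. Qed.

Lemma causalD f g : causal (f \+ g) = causal f \+ causal g.
Proof. by apply/funext => t; rewrite /causal/=; case: ifP; rewrite ?addr0. Qed.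

Lemma causalZ c f : causal (fun t => c * f t) = fun t => c * causal f t.
Proof. by apply/funext => t; rewrite /causal/=; case: ifP; rewrite ?mulr0. Qed.

Lemma conv_causalE f g t :
  conv f g t = \int[mu]_x (causal f (t - x) * causal g x).
Proof.
rewrite /conv Rintegral_mkcond; apply: eq_Rintegral => x _.
rewrite patchE /causal subr_gt0 mem_setE in_itv/=.
by case: (0 < x); case: (x < t); rewrite /= ?mulr0 ?mul0r.
Qed.

Lemma conv_eq f f' g g' : (forall t, 0 < t -> f t = f' t) ->
  (forall t, 0 < t -> g t = g' t) -> conv f g = conv f' g'.
Proof.
move=> ff gg; apply/funext => t; rewrite !conv_causalE.
by rewrite (causal_eq ff) (causal_eq gg).
Qed.

Lemma conv_le0 f g t : t <= 0 -> conv f g t = 0.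
Proof. by move=> t0; rewrite /conv set_itv_ge ?Rintegral_set0// bnd_simp -leNgt. Qed.

(** For t <= 0 the interval of integration is empty, so a convolution already vanishes there. *)
Lemma causal_conv f g : causal (conv f g) = conv f g.
Proof.
by apply/funext => t; rewrite /causal; case: ltP => // t0; rewrite conv_le0.
Qed.

(** Replaces the continuous factor of a function in C_{-1} by one continuous on the whole line with
    the same values on the half-line. *)
Lemma continuous_comp_max0 f : {within `[0, +oo[, continuous f} ->
  continuous (fun x : R => f (Num.max 0 x)).
Proof.
move=> /subspace_continuousP cf x.
have m0 y : 0 <= Num.max 0 y :> R by rewrite le_max lexx.
apply: (@cvg_comp _ _ _ _ _ _ (within `[0, +oo[ (nbhs (Num.max 0 x)))); last first.
  by apply: cf; rewrite /= in_itv/= m0.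
move=> A /=; rewrite /within/= => nA.
have cm : continuous (fun y : R => Num.max 0 y).
  move=> y; apply: (@continuous_max _ _ (fun=> 0) id y).
    exact: cvg_cst.
  exact: cvg_id.
move: (cm x _ nA); apply: (@filterS _ (nbhs x)) => y; apply.
by rewrite /= in_itv/= m0.
Qed.

Lemma Cm1P f : Cm1 f <-> exists p f1,
  [/\ -1 < p, continuous f1 & forall t, 0 < t -> f t = t `^ p * f1 t].
Proof.
split=> [[p [f1 [p1 cf1 fE]]]|[p [f1 [p1 cf1 fE]]]].
  exists p, (fun x => f1 (Num.max 0 x)); split => //.
    exact: continuous_comp_max0.
  by move=> t t0; rewrite fE// max_r// ltW.
by exists p, f1; split => //; exact: continuous_subspaceT.
Qed.

Lemma measurable_causal f : Cm1 f -> measurable_fun setT (causal f).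
Proof.
move=> /Cm1P[p [f1 [p1 cf1 fE]]].
have -> : causal f = (fun t => t `^ p * f1 t) \_ `]0, +oo[.
  apply/funext => t; rewrite patchE /causal; case: ifPn => [t0|].
    by rewrite fE// mem_set//= in_itv/= t0.
  by move=> t0; rewrite memNset//= in_itv/= (negbTE t0).
apply/(measurable_restrictT _ (measurable_itv _)); apply: measurable_funTS.
apply: measurable_funM; first exact: measurable_powR.
exact: continuous_measurable_fun.
Qed.

Lemma Cm1_continuous f t : Cm1 f -> 0 < t -> {for t, continuous f}.
Proof.
move=> /Cm1P[p [f1 [p1 cf1 fE]]] t0.
have : {for t, continuous (fun x => x `^ p * f1 x)}.
  by apply: continuousM; [exact: continuous_powR|exact: cf1].
rewrite /prop_for /continuous_at -(fE _ t0); apply: cvg_trans.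
apply: near_eq_cvg; near=> x; apply/esym/fE; near: x; exact: lt_nbhsr.
Unshelve. all: by end_near. Qed.

Lemma continuous_bounded f (T : R) : continuous f ->
  exists2 M, 0 <= M & forall x, `|x| <= T -> `|f x| <= M.
Proof.
move=> cf; have [T0|T0] := leP 0 T; last first.
  by exists 0 => // x /le_lt_trans/(_ T0); rewrite normr_lt0.
have [||c _ cm] := @EVT_max R (fun x => `|f x|) (- T) T; first by lra.
  by apply: continuous_subspaceT => x; apply: cvg_norm; exact: cf.
exists `|f c| => // x xT; apply: cm.
by rewrite in_itv/= -ler_norml.
Qed.

Section kernel.
Variables (p q : R) (f1 g1 : R -> R).
Hypotheses (p1 : -1 < p) (q1 : -1 < q).
Hypotheses (cf1 : continuous f1) (cg1 : continuous g1).

(* The substitution tau = t u turns the convolution of t^p f1 and t^q g1 into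
   t^(p+q+1) times the integral of this kernel over u. *)
Definition beta_kernel t u :=
  (1 - u) `^ p * u `^ q * (f1 (t * (1 - u)) * g1 (t * u)).

Lemma measurable_beta_kernel t : measurable_fun setT (beta_kernel t).
Proof.
have m1 : measurable_fun setT (fun u : R => 1 - u) by apply: measurable_funB.
apply: measurable_funM; apply: measurable_funM.
- exact: (measurableT_comp (measurable_powR p)).
- exact: measurable_powR.
- apply: (measurableT_comp (continuous_measurable_fun cf1)).
  exact: measurable_funM.
- apply: (measurableT_comp (continuous_measurable_fun cg1)).
  exact: measurable_funM.
Qed.

(** The continuous factors are bounded on [-T, T], and [beta_bound] replaces the product of two
    powers by a sum in which each term has a single integrable singularity. One G serves all these
    t, as dominated convergence demands. *)
Lemma beta_kernel_bound T : exists2 G : R -> R,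
  mu.-integrable `]0, 1[ (EFin \o G) &
  forall t u, `|t| <= T -> 0 < u < 1 -> `|beta_kernel t u| <= G u.
Proof.
have [M M0 fM] := continuous_bounded T cf1.
have [N N0 gN] := continuous_bounded T cg1.
exists (fun u => (M * N * 2) * ((1 - u) `^ p + u `^ q)).
  apply: (@integrableZl _ _ _ mu _ _ (M * N * 2)
    (fun u : R => ((1 - u) `^ p)%:E + (u `^ q)%:E)%E) => //.
  by apply: integrableD => //; [exact: integrable_powR_onem|exact: integrable_powR].
move=> t u tT u01.
rewrite /beta_kernel !normrM (ger0_norm (powR_ge0 _ _)) (ger0_norm (powR_ge0 _ _)).
rewrite mulrC -mulrA; apply: ler_pM; rewrite ?mulr_ge0 ?powR_ge0//.
  apply: ler_pM => //; [apply: fM|apply: gN].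
    rewrite normrM -[leRHS]mulr1; apply: ler_pM => //.
    by rewrite ger0_norm; lra.
  rewrite normrM -[leRHS]mulr1; apply: ler_pM => //.
  by rewrite ger0_norm; lra.
exact: beta_bound.
Qed.

Lemma integrable_beta_kernel t :
  mu.-integrable `]0, 1[ (EFin \o beta_kernel t).
Proof.
have [G iG kG] := beta_kernel_bound `|t|.
apply: (le_integrable _ _ _ iG) => //.
  by apply/measurable_EFinP; apply: measurable_funTS; exact: measurable_beta_kernel.
move=> u; rewrite /= in_itv/= => u01; rewrite lee_fin.
by rewrite (le_trans (kG _ _ _ u01))// ler_norm.
Qed.

(** This integral is the continuous factor of the convolution as an element of C_{-1}; continuity at
    t = 0 is therefore included. *)
Lemma continuous_beta_kernel :
  continuous (fun t => \int[mu]_(u in `]0, 1[) beta_kernel t u).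
Proof.
(* With this T the point t is interior to the interval on which G dominates. *)
move=> t; pose T := `|t| + 1.
have [G iG kG] := beta_kernel_bound T.
have tT : t \in `]-T, T[%classic.
  by rewrite inE/= in_itv/= -ltr_norml /T ltrDl.
apply: (@continuity_under_integral _ _ _ mu beta_kernel _ _ (- T) T _ _ G iG _ t tT).
- exact: measurable_itv.
- by move=> x _; exact: integrable_beta_kernel.
- apply/aeW => u _ x _.
  apply: cvgM; first exact: cvg_cst.
  by apply: continuousM; apply: continuous_comp;
    [apply: continuousM => //; exact: cvg_cst|exact: cf1
    |apply: continuousM => //; exact: cvg_cst|exact: cg1].
- move=> x; rewrite /= in_itv/= -ltr_norml => xT; apply/aeW => u.
  by rewrite /= in_itv/=; apply: kG; exact: ltW.
Qed.

End kernel.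

End causal_functions.

(** * The convolution on C_{-1} *)

Section convolution.
Context {R : realType}.
Local Notation mu := (@lebesgue_measure R).
Implicit Types (f g h : R -> R) (p q t x : R).

Lemma integrable_patch (i : interval R) f :
  mu.-integrable [set` i] (EFin \o f) <->
  mu.-integrable setT (EFin \o (f \_ [set` i])).
Proof.
rewrite -restrict_EFin.
exact: (integrable_mkcond (mu := mu) (D := [set` i]) (EFin \o f) (measurable_itv _)).
Qed.

Definition convolved f g t x := causal f (t - x) * causal g x.

Lemma measurable_convolved f g t : Cm1 f -> Cm1 g ->
  measurable_fun setT (convolved f g t).
Proof.
move=> hf hg; apply: measurable_funM; last exact: measurable_causal.
by apply: (measurableT_comp (measurable_causal hf)); apply: measurable_funB.
Qed.

Lemma conv_beta p q f1 g1 f g t : -1 < p -> -1 < q ->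
  continuous f1 -> continuous g1 ->
  (forall t, 0 < t -> f t = t `^ p * f1 t) ->
  (forall t, 0 < t -> g t = t `^ q * g1 t) -> 0 < t ->
  mu.-integrable setT (EFin \o convolved f g t) /\
  conv f g t = t `^ (p + q + 1) * \int[mu]_(u in `]0, 1[) beta_kernel p q f1 g1 t u.
Proof.
move=> p1 q1 cf1 cg1 fE gE t0.
have hf : Cm1 f by apply/Cm1P; exists p, f1.
have hg : Cm1 g by apply/Cm1P; exists q, g1.
have E u : convolved f g t (t * u) =
    t `^ (p + q) * (beta_kernel p q f1 g1 t \_ `]0, 1[) u.
  rewrite patchE /convolved /causal mem_setE in_itv/=.
  have -> : t - t * u = t * (1 - u) by rewrite mulrBr mulr1.
  rewrite !pmulr_rgt0// subr_gt0.
  have [u0|u0] := ltP 0 u; have [u1|u1] := ltP u 1; rewrite /= ?mulr0 ?mul0r//.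
  have u1' : 0 < 1 - u by lra.
  rewrite fE ?mulr_gt0// gE ?mulr_gt0// /beta_kernel !powRM ?ltW//.
  by rewrite powRD ?(gt_eqF t0) ?implybT//; ring.
have iK := integrable_beta_kernel p1 q1 cf1 cg1 t.
have iF : mu.-integrable setT (fun u => (convolved f g t (t * u))%:E).
  under eq_fun do rewrite E EFinM.
  apply: integrableZl => //.
  exact/integrable_patch.
have [iF' convE] := Rintegral_scale t0 (measurable_convolved t hf hg) iF.
split=> //; rewrite conv_causalE; move: convE; rewrite {1}/convolved => ->.
(* The two powers give t^(p+q), and d tau = t du gives the remaining factor t. *)
have -> : p + q + 1 = 1 + (p + q) by ring.
rewrite (@powRD _ t 1 (p + q)) ?(gt_eqF t0) ?implybT// powRr1 ?ltW// -mulrA.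
congr (_ * _); under eq_Rintegral do rewrite E.
rewrite RintegralZl//; last first.
  exact/integrable_patch.
by rewrite -Rintegral_mkcond.
Qed.

Lemma integrable_convolved f g t : Cm1 f -> Cm1 g ->
  mu.-integrable setT (EFin \o convolved f g t).
Proof.
move=> /Cm1P[p [f1 [p1 cf1 fE]]] /Cm1P[q [g1 [q1 cg1 gE]]].
have [t0|t0] := ltP 0 t; first by have [] := conv_beta p1 q1 cf1 cg1 fE gE t0.
(* For t <= 0 the conditions x > 0 and t - x > 0 exclude each other. *)
have -> : convolved f g t = fun=> 0; last exact: integrable0.
apply/funext => x; rewrite /convolved /causal.
by case: ltP => a; case: ltP => b; rewrite ?mulr0 ?mul0r//; lra.
Qed.

Lemma Cm1_conv f g : Cm1 f -> Cm1 g -> Cm1 (conv f g).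
Proof.
move=> /Cm1P[p [f1 [p1 cf1 fE]]] /Cm1P[q [g1 [q1 cg1 gE]]]; apply/Cm1P.
exists (p + q + 1), (fun t => \int[mu]_(u in `]0, 1[) beta_kernel p q f1 g1 t u).
split; [lra|exact: continuous_beta_kernel|].
by move=> t t0; have [] := conv_beta p1 q1 cf1 cg1 fE gE t0.
Qed.

Lemma conv_existsP f g t : Cm1 f -> Cm1 g -> conv_exists f g t.
Proof.
move=> hf hg; apply/(integrable_patch _ (fun x => f (t - x) * g x)).
rewrite (_ : _ \_ _ = convolved f g t); first exact: integrable_convolved.
apply/funext => x; rewrite patchE /convolved /causal subr_gt0 mem_setE in_itv/=.
by case: (0 < x); case: (x < t); rewrite /= ?mulr0 ?mul0r.
Qed.

Lemma convE f g t : conv f g t = \int[mu]_x convolved f g t x.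
Proof. exact: conv_causalE. Qed.

Lemma convC f g : Cm1 f -> Cm1 g -> conv f g = conv g f.
Proof.
move=> hf hg; apply/funext => t; rewrite !convE /Rintegral; congr fine.
rewrite -(@integral_reflect _ t); last first.
  by apply/measurable_EFinP; exact: measurable_convolved.
by apply: eq_integral => x _; rewrite /convolved subKr mulrC.
Qed.

Lemma convDl f g h : Cm1 f -> Cm1 g -> Cm1 h ->
  conv (f \+ g) h = conv f h \+ conv g h.
Proof.
move=> hf hg hh; apply/funext => t; rewrite /= !convE.
rewrite -RintegralD//; [|exact: integrable_convolved..].
by apply: eq_Rintegral => x _; rewrite /convolved causalD mulrDl.
Qed.

Lemma convZl c f g : Cm1 f -> Cm1 g ->
  conv (fun t => c * f t) g = fun t => c * conv f g t.
Proof.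
move=> hf hg; apply/funext => t; rewrite /= !convE.
rewrite -RintegralZl//; [|exact: integrable_convolved].
by apply: eq_Rintegral => x _; rewrite /convolved causalZ mulrA.
Qed.

Lemma conv0l f t : conv (fun=> 0) f t = 0.
Proof.
rewrite convE /Rintegral integral0_eq// => x _.
by rewrite /convolved /causal; case: ifP; rewrite mul0r.
Qed.

Lemma Cm1_norm f : Cm1 f -> Cm1 (fun t => `|f t|).
Proof.
move=> /Cm1P[p [f1 [p1 cf1 fE]]]; apply/Cm1P; exists p, (fun t => `|f1 t|).
split => //; first by move=> x; apply: cvg_norm; exact: cf1.
by move=> t t0; rewrite fE// normrM ger0_norm// powR_ge0.
Qed.

Lemma causal_norm f x : causal (fun t => `|f t|) x = `|causal f x|.
Proof. by rewrite /causal; case: ifP; rewrite ?normr0. Qed.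

(** Fubini for f(t-x) g(x-y) h(y). Integrability on the plane comes from the same iterated integral
    for the absolute values: these lie in C_{-1}, so it is a convolution of functions of C_{-1} and
    hence finite. In the other order the inner integral becomes a convolution after translating x by
    y. *)
Lemma convA f g h : Cm1 f -> Cm1 g -> Cm1 h ->
  conv f (conv g h) = conv (conv f g) h.
Proof.
move=> hf hg hh; apply/funext => t; rewrite !convE.
pose F (z : R * R) := causal f (t - z.1) * (causal g (z.1 - z.2) * causal h z.2).
have mF : measurable_fun setT F.
  apply: measurable_funM; last apply: measurable_funM.
  - apply: (measurableT_comp (measurable_causal hf)).
    by apply: measurable_funB.
  - apply: (measurableT_comp (measurable_causal hg)).
    by apply: measurable_funB.
  - exact: (measurableT_comp (measurable_causal hh)).
have inner (u v : R -> R) s : Cm1 u -> Cm1 v ->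
    (\int[mu]_x (convolved u v s x)%:E = (conv u v s)%:E)%E.
  move=> hu hv; rewrite convE fineK//.
  by apply: integrable_fin_num => //; exact: integrable_convolved.
have iF : (mu \x mu)%E.-integrable setT (EFin \o F).
  apply/integrable12ltyP; first exact/measurable_EFinP.
  pose af x := `|f x|; pose ag x := `|g x|; pose ah x := `|h x|.
  have [haf hag hah] : [/\ Cm1 af, Cm1 ag & Cm1 ah] by split; exact: Cm1_norm.
  have -> : (\int[mu]_x \int[mu]_y `|(EFin \o F) (x, y)| =
             \int[mu]_x (convolved af (conv ag ah) t x)%:E)%E.
    apply: eq_integral => x _; rewrite /convolved causal_conv EFinM -inner//.
    rewrite -integralZl//; last exact: integrable_convolved.
    apply: eq_integral => y _.
    by rewrite /F/= /convolved !causal_norm !normrM.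
  rewrite inner ?ltry//; exact: Cm1_conv.
have := @Fubini _ _ _ _ _ mu mu _ iF.
have -> : (\int[mu]_x \int[mu]_y (EFin \o F) (x, y) =
           \int[mu]_x (convolved f (conv g h) t x)%:E)%E.
  apply: eq_integral => x _; rewrite /convolved causal_conv EFinM -inner//.
  by rewrite -integralZl//; exact: integrable_convolved.
have -> : (\int[mu]_y \int[mu]_x (EFin \o F) (x, y) =
           \int[mu]_y (convolved (conv f g) h t y)%:E)%E.
  apply: eq_integral => y _; rewrite /convolved causal_conv mulrC EFinM -inner//.
  rewrite -integralZl//; last exact: integrable_convolved.
  rewrite -[RHS](@integral_translate _ y); last first.
    apply: emeasurable_funM => //; apply/measurable_EFinP.
    exact: measurable_convolved.
  apply: eq_integral => x _.
  rewrite /F/= /convolved -EFinM; congr EFin.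
  have -> : t - y - (x - y) = t - x by ring.
  by ring.
by rewrite /Rintegral => ->.
Qed.

End convolution.

(** * Convolution with the function 1 *)

Section primitive.
Context {R : realType}.
Local Notation mu := (@lebesgue_measure R).
Implicit Types (f g h : R -> R) (p q t x : R).

Lemma Cm1_cst (c : R) : Cm1 (fun _ : R => c).
Proof.
apply/Cm1P; exists 0, (fun=> c); split; first by lra.
  by move=> x; exact: cvg_cst.
by move=> t _; rewrite powRr0 mul1r.
Qed.

(** This is the existence of 1 * g at u + 1, a point chosen so that ]0, u] lies in the open interval
    of integration. *)
Lemma Cm1_integrable g (u : R) : Cm1 g -> mu.-integrable `]0, u] (EFin \o g).
Proof.
move=> hg; apply: (@integrableS _ _ R mu `]0%R, (u + 1)%R[%classic) => //.
  by apply: subset_itvl; rewrite bnd_simp ltrDl.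
have -> : EFin \o g = fun x => ((fun=> 1) (u + 1 - x) * g x)%:E.
  by apply/funext => x; rewrite mul1r.
exact: (conv_existsP (u + 1) (Cm1_cst 1) hg).
Qed.

Lemma conv1E g (t : R) : Cm1 g -> conv (fun=> 1) g t = \int[mu]_(x in `]0, t]) g x.
Proof.
move=> hg; rewrite /conv; under eq_Rintegral do rewrite /= mul1r.
apply: Rintegral_itv_bndo_bndc; apply: integrableS (Cm1_integrable t hg) => //.
by apply: subset_itvl; rewrite bnd_simp.
Qed.

Lemma derive_conv1 g t : Cm1 g -> 0 < t ->
  derivable (conv (fun=> 1) g) t 1 /\ (conv (fun=> 1) g)^`()%classic t = g t.
Proof.
move=> hg t0.
have -> : conv (fun=> 1) g = fun y => \int[mu]_(x in `]0, y]) g x.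
  by apply/funext => y; exact: conv1E.
apply: (@continuous_FTC1 _ g (BRight 0) t (t + 1)).
- by rewrite ltrDl.
- exact: Cm1_integrable.
- by rewrite lte_fin.
- exact: Cm1_continuous.
Qed.

Lemma conv1_eq0 g : Cm1 g -> (forall t, 0 < t -> conv (fun=> 1) g t = 0) ->
  forall t, 0 < t -> g t = 0.
Proof.
move=> hg g0 t t0; have [_ <-] := derive_conv1 hg t0.
rewrite derive1E (@near_eq_derive _ _ _ _ (fun=> 0)) ?derive_cst//.
by near=> x; apply: g0; near: x; exact: lt_nbhsr.
Unshelve. all: by end_near. Qed.

(** By [conv_beta] with p = 0, the convolution is t^(q+1) times a function continuous at 0, and q +
    1 > 0. *)
Lemma cvg_conv1_0 g : Cm1 g -> conv (fun=> 1) g t @[t --> 0^'+] --> 0.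
Proof.
move=> /Cm1P[q [g1 [q1 cg1 gE]]].
pose H t := \int[mu]_(u in `]0, 1[) beta_kernel 0 q (fun=> 1) g1 t u.
have p1 : -1 < 0 :> R by lra.
have c1 : continuous (fun _ : R => 1 : R) by move=> x; exact: cvg_cst.
have E1 t : 0 < t -> (1 : R) = t `^ 0 * 1 by rewrite powRr0 mul1r.
have : t `^ (0 + q + 1) * H t @[t --> 0^'+] --> 0.
  rewrite -[X in _ --> X](mul0r (H 0)); apply: cvgM; first by apply: powR_cvg0; lra.
  by apply: cvg_at_right_filter; apply: continuous_beta_kernel.
apply: cvg_trans; apply: near_eq_cvg; near=> t.
have t0 : 0 < t by near: t; exact: nbhs_right_gt.
by have [_ ->] := conv_beta p1 q1 c1 cg1 E1 gE t0.
Unshelve. all: by end_near. Qed.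

(** The difference of h and 1 * g has zero derivative, so it is constant by the mean value theorem;
    as 1 * g tends to 0, that constant is the limit of h. The limit thus exists, and [lim] is not a
    default value. *)
Lemma primitive_conv1 h g : Cm1 g ->
  (forall t, 0 < t -> derivable h t 1 /\ h^`()%classic t = g t) ->
  forall t, 0 < t -> h t = lim (h x @[x --> 0^'+]) + conv (fun=> 1) g t.
Proof.
move=> hg hh.
pose d t := h t - conv (fun=> 1) g t.
have dd t : 0 < t -> is_derive t 1 d 0.
  move=> t0; have [h1 h2] := hh t t0; have [g1 g2] := derive_conv1 hg t0.
  split; first exact: derivableB.
  by rewrite deriveB// -!derive1E h2 g2 subrr.
have dc s t : 0 < s -> s < t -> d t = d s.
  move=> s0 st.
  have [||c _] := @MVT R d (fun=> 0) s t st.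
  - by move=> x; rewrite in_itv/= => /andP[sx _]; apply: dd; lra.
  - apply: continuous_in_subspaceT => x; rewrite inE/= in_itv/= => /andP[sx _].
    apply: differentiable_continuous; apply/derivable1_diffP.
    by have [] := dd x (lt_le_trans s0 sx).
  - by rewrite mul0r => /eqP; rewrite subr_eq0 => /eqP.
have d1 t : 0 < t -> d t = d 1.
  move=> t0; case: (ltgtP t 1) => [t1|t1|->//]; first by rewrite (dc _ _ t0 t1).
  by apply: dc.
have hE t : 0 < t -> h t = d 1 + conv (fun=> 1) g t.
  by move=> t0; rewrite -(d1 _ t0) /d subrK.
have -> : lim (h x @[x --> 0^'+]) = d 1; last exact: hE.
apply: cvg_lim => //; rewrite -[X in _ --> X]addr0.
have : d 1 + conv (fun=> 1) g t @[t --> 0^'+] --> d 1 + 0.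
  by apply: cvgD; [exact: cvg_cst|exact: cvg_conv1_0].
apply: cvg_trans; apply: near_eq_cvg; near=> t; apply/esym/hE.
by near: t; exact: nbhs_right_gt.
Unshelve. all: by end_near. Qed.

End primitive.

(** * The convolution ring with a unit adjoined *)

Section closure.
Context {R : realType}.
Implicit Types (f g h : R -> R) (p q t x : R).

Lemma continuous_powR_max0 (r : R) : 0 <= r ->
  continuous (fun x : R => Num.max 0 x `^ r).
Proof.
rewrite le_eqVlt => /predU1P[<-|r0].
  (* The exponent 0 is separate because 0^0 = 1, while 0^r = 0 for r > 0. *)
  by under eq_fun do rewrite powRr0; move=> x; exact: cvg_cst.
apply: (@continuous_comp_max0 _ (fun x => x `^ r)).
apply/continuous_within_itvcyP; split.
  by move=> x; rewrite in_itv/= andbT; exact: continuous_powR.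
by rewrite powR0 ?gt_eqF//; exact: powR_cvg0.
Qed.

Lemma Cm1Z (c : R) f : Cm1 f -> Cm1 (fun t => c * f t).
Proof.
move=> /Cm1P[p [f1 [p1 cf1 fE]]]; apply/Cm1P; exists p, (fun t => c * f1 t).
split=> //; last by move=> t t0; rewrite fE// mulrCA.
by move=> x; apply: cvgM; [exact: cvg_cst|exact: cf1].
Qed.

(** Factor out the smaller exponent: for p <= q the sum is t^p (f1 + t^(q-p) g1). *)
Lemma Cm1D f g : Cm1 f -> Cm1 g -> Cm1 (f \+ g).
Proof.
move=> /Cm1P[p [f1 [p1 cf1 fE]]] /Cm1P[q [g1 [q1 cg1 gE]]].
wlog pq : f g p q f1 g1 p1 q1 cf1 cg1 fE gE / p <= q.
  move=> H; have [pq|/ltW qp] := leP p q; first exact: (H f g p q f1 g1).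
  have -> : f \+ g = g \+ f by apply/funext => x; rewrite /= addrC.
  exact: (H g f q p g1 f1).
apply/Cm1P; exists p, (fun t => f1 t + Num.max 0 t `^ (q - p) * g1 t).
split=> //.
  move=> x; apply: cvgD; first exact: cf1.
  by apply: cvgM; [apply: continuous_powR_max0; lra|exact: cg1].
move=> t t0; rewrite /= fE// gE// max_r ?(ltW t0)// mulrDr mulrA -powRD.
  by congr (_ + t `^ _ * _); ring.
by rewrite (gt_eqF t0) implybT.
Qed.

End closure.

Section unitization.
Context {R : realType}.
Implicit Types (f g h : R -> R).

(** Causality selects one representative for each function on (0,+oo), so that the ring laws can
    hold as equalities of pairs. *)
Definition causal_pair : {pred R * (R -> R)} :=
  fun x => `[< Cm1 x.2 /\ causal x.2 = x.2 >].

Lemma causal_pairP (x : R * (R -> R)) :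
  reflect (Cm1 x.2 /\ causal x.2 = x.2) (x \in causal_pair).
Proof. exact: asboolP. Qed.

Lemma causal_pair_zmod_closed : zmod_closed causal_pair.
Proof.
split.
  apply/causal_pairP; split; first exact: (Cm1_cst 0).
  by apply/funext => t; rewrite /causal; case: ifP.
move=> x y /causal_pairP[hx cx] /causal_pairP[hy cy]; apply/causal_pairP.
have E : (x - y).2 = x.2 \+ (fun t => -1 * y.2 t).
  by apply/funext => t; rewrite /= mulN1r.
by rewrite E; split; [apply: Cm1D => //; exact: Cm1Z|rewrite causalD causalZ cx cy].
Qed.

HB.instance Definition _ := GRing.isZmodClosed.Build (R * (R -> R))%type
  causal_pair causal_pair_zmod_closed.

(* The pair (c, f) stands for c delta + f. *)
Record unitization := Unitization {
  uval : R * (R -> R); uvalP : uval \in causal_pair }.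

HB.instance Definition _ := [isSub for uval].
HB.instance Definition _ := [Choice of unitization by <:].
HB.instance Definition _ := [SubChoice_isSubZmodule of unitization by <:].

Notation A := unitization.
Implicit Types (x y z : unitization).

Lemma uval_Cm1 x : Cm1 (uval x).2.
Proof. by case/causal_pairP: (uvalP x). Qed.
#[local] Hint Resolve uval_Cm1 : core.

Lemma uval_causal x : causal (uval x).2 = (uval x).2.
Proof. by case/causal_pairP: (uvalP x). Qed.

Lemma convDr f g h : Cm1 f -> Cm1 g -> Cm1 h ->
  conv h (f \+ g) = conv h f \+ conv h g.
Proof.
move=> hf hg hh; rewrite convC// ?convDl//; last exact: Cm1D.
by rewrite (convC hf)// (convC hg).
Qed.

Lemma convZr c f g : Cm1 f -> Cm1 g ->
  conv g (fun t => c * f t) = fun t => c * conv g f t.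
Proof.
by move=> hf hg; rewrite convC// ?convZl// ?(convC hf)//; exact: Cm1Z.
Qed.

(** Expansion of (c delta + f) * (d delta + g), with delta as unit. *)
Definition umul_pair x y : R * (R -> R) :=
  ((uval x).1 * (uval y).1,
   ((fun t => (uval x).1 * (uval y).2 t) \+ (fun t => (uval y).1 * (uval x).2 t))
     \+ conv (uval x).2 (uval y).2).

Lemma umul_subproof x y : umul_pair x y \in causal_pair.
Proof.
apply/causal_pairP; split.
  by apply: Cm1D; [apply: Cm1D; exact: Cm1Z|exact: Cm1_conv].
by rewrite /= !causalD !causalZ !uval_causal causal_conv.
Qed.

Definition umul x y := Unitization (umul_subproof x y).

Lemma uscal_subproof (c : R) : (c, fun=> 0) \in causal_pair.
Proof.
apply/causal_pairP; split; first exact: (Cm1_cst 0).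
by apply/funext => t; rewrite /causal; case: ifP.
Qed.

(** The element c delta: scalar multiples of functions become products in the ring. *)
Definition uscal (c : R) := Unitization (uscal_subproof c).

Definition uone := uscal 1.

Lemma unitization_eq x y :
  (uval x).1 = (uval y).1 -> (uval x).2 =1 (uval y).2 -> x = y.
Proof.
move=> e1 /funext e2; apply: val_inj => /=.
by rewrite [LHS]surjective_pairing [RHS]surjective_pairing e1 e2.
Qed.

Lemma umulC : commutative umul.
Proof.
move=> x y; apply: unitization_eq => [|t] /=; first exact: mulrC.
by rewrite (convC (uval_Cm1 x)) //; ring.
Qed.

Lemma umulA : associative umul.
Proof.
move=> x y z; apply: unitization_eq => [|t] /=; first exact: mulrA.
have Z c (u : A) : Cm1 (fun t => c * (uval u).2 t) by exact: Cm1Z.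
rewrite !(convDr, convDl, convZr, convZl)//;
  try by repeat (exact: Cm1_conv || exact: Z || apply: Cm1D).
by rewrite /= convA//; ring.
Qed.

Lemma umul1x : left_id uone umul.
Proof.
move=> x; apply: unitization_eq => [|t] /=; first exact: mul1r.
by rewrite conv0l; ring.
Qed.

Lemma umulDl : left_distributive umul +%R.
Proof.
move=> x y z; apply: unitization_eq => [|t]; first exact: mulrDl.
transitivity (((uval x).1 + (uval y).1) * (uval z).2 t +
  (uval z).1 * ((uval x).2 t + (uval y).2 t) +
  conv ((uval x).2 \+ (uval y).2) (uval z).2 t); first by [].
transitivity ((uval (umul x z)).2 t + (uval (umul y z)).2 t); last by [].
by rewrite convDl//=; ring.
Qed.

Lemma uone_neq0 : uone != 0.
Proof. by apply/eqP => /(congr1 (fun x => (uval x).1))/= /eqP; rewrite oner_eq0. Qed.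

HB.instance Definition _ := GRing.Zmodule_isComNzRing.Build A
  umulA umulC umul1x umulDl uone_neq0.

End unitization.

(** * Embedding of C_{-1} into the unitization, and cancellable functions *)

Section embedding.
Context {R : realType}.
Implicit Types (f g h a b : R -> R) (x y : unitization (R := R)).
Local Notation A := (unitization (R := R)).

(** Outside C_{-1} the value is the default 0, so the component along delta is 0 for every f. *)
Definition emb f : A := insubd 0 (0, causal f).

Lemma Cm1_causal f : Cm1 f -> Cm1 (causal f).
Proof.
move=> /Cm1P[p [f1 [p1 cf1 fE]]]; apply/Cm1P; exists p, f1; split => //.
by move=> t t0; rewrite causal_pos// fE.
Qed.

Lemma uval_emb f : Cm1 f -> uval (emb f) = (0, causal f).
Proof.
move=> hf; rewrite /emb (insubdK _)//; apply/causal_pairP; split.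
  exact: Cm1_causal.
by apply/funext => t; rewrite /= /causal; case: (0 < t).
Qed.

Lemma uval1_emb f : (uval (emb f)).1 = 0.
Proof. by rewrite /emb [uval _]val_insubd; case: ifP. Qed.

Lemma uval1D x y : (uval (x + y)).1 = (uval x).1 + (uval y).1. Proof. by []. Qed.
Lemma uval1B x y : (uval (x - y)).1 = (uval x).1 - (uval y).1. Proof. by []. Qed.
Lemma uval1M x y : (uval (x * y)).1 = (uval x).1 * (uval y).1. Proof. by []. Qed.

Definition uval1E := (uval1M, uval1D, uval1_emb, mul0r, mulr0, addr0).

Lemma emb_ext f g : (forall t, 0 < t -> f t = g t) -> emb f = emb g.
Proof. by move=> /causal_eq fg; rewrite /emb fg. Qed.

Lemma emb_inj f g : Cm1 f -> Cm1 g -> emb f = emb g ->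
  forall t, 0 < t -> f t = g t.
Proof.
move=> hf hg /(congr1 (fun x => (uval x).2)); rewrite !uval_emb//= => fg t t0.
by move/(congr1 (@^~ t)) : fg; rewrite !causal_pos.
Qed.

Lemma emb_uval x : (uval x).1 = 0 -> emb (uval x).2 = x.
Proof.
move=> x0; apply: unitization_eq; first by rewrite uval1_emb x0.
by move=> t; rewrite uval_emb ?uval_causal//; exact: uval_Cm1.
Qed.

Lemma embM f g : Cm1 f -> Cm1 g -> emb (conv f g) = emb f * emb g.
Proof.
move=> hf hg; apply: unitization_eq; first by rewrite !uval1E.
move=> t; rewrite uval_emb; last exact: Cm1_conv.
transitivity ((uval (emb f)).1 * (uval (emb g)).2 t +
  (uval (emb g)).1 * (uval (emb f)).2 t +
  conv (uval (emb f)).2 (uval (emb g)).2 t); last by [].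
rewrite !uval1_emb !mul0r !add0r !uval_emb//= causal_conv.
by rewrite (@conv_eq _ f (causal f) g (causal g))// => s s0; rewrite causal_pos.
Qed.

Lemma embD f g : Cm1 f -> Cm1 g -> emb (fun t => f t + g t) = emb f + emb g.
Proof.
move=> hf hg; apply: unitization_eq; first by rewrite !uval1E.
move=> t; rewrite uval_emb; last exact: Cm1D.
transitivity ((uval (emb f)).2 t + (uval (emb g)).2 t); last by [].
by rewrite !uval_emb//= -[LHS]/(causal (f \+ g) t) causalD.
Qed.

Lemma embZ c f : Cm1 f -> emb (fun t => c * f t) = uscal c * emb f.
Proof.
move=> hf; apply: unitization_eq; first by rewrite !uval1E.
move=> t; rewrite uval_emb; last exact: Cm1Z.
transitivity (c * (uval (emb f)).2 t + (uval (emb f)).1 * 0 +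
  conv (fun=> 0) (uval (emb f)).2 t); last by [].
by rewrite conv0l mulr0 !addr0 uval_emb//= causalZ.
Qed.

(** Cancellation is tested on functions only; [regular_cancel] extends it to all elements without a
    delta component, among which the equations between fractions live. *)
Definition regular b :=
  Cm1 b /\ forall g, Cm1 g -> emb b * emb g = 0 -> emb g = 0.

Lemma regular_cancel b x y : regular b -> (uval x).1 = 0 -> (uval y).1 = 0 ->
  emb b * x = emb b * y -> x = y.
Proof.
move=> [hb rb] x0 y0 e; apply/eqP; rewrite -subr_eq0; apply/eqP.
have z0 : (uval (x - y)).1 = 0 by rewrite uval1B x0 y0 subrr.
rewrite -(emb_uval z0); apply: rb; first exact: uval_Cm1.
by rewrite emb_uval// mulrBr e subrr.
Qed.

Lemma regular_conv a b : regular a -> regular b -> regular (conv a b).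
Proof.
move=> [ha ra] [hb rb]; split; first exact: Cm1_conv.
move=> g hg; rewrite embM// -mulrA -embM// => /(ra _ (Cm1_conv hb hg)).
by rewrite embM//; exact: rb.
Qed.

Lemma regular_one : regular (fun=> 1).
Proof.
split; first exact: Cm1_cst.
move=> g hg; rewrite -embM//; last exact: Cm1_cst.
move=> e; have h1g := Cm1_conv (Cm1_cst 1) hg.
have : forall t, 0 < t -> conv (fun=> 1) g t = 0.
  move=> t t0; move/(congr1 (fun x => (uval x).2 t)) : e.
  by rewrite uval_emb//= causal_pos.
move=> /(conv1_eq0 hg) g0; apply: unitization_eq; first by rewrite uval1_emb.
move=> t; rewrite uval_emb//= /causal; case: ifP => // t0; exact: g0.
Qed.

Lemma regular_dvd_one a x : Cm1 a -> emb a * x = emb (fun=> 1) -> regular a.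
Proof.
move=> ha e; split => // g hg ag0; case: regular_one => _; apply => //.
by rewrite -e mulrAC ag0 mul0r.
Qed.

End embedding.

(** * Convolution quotients with cancellable denominators *)

Section fractions.
Context {R : realType}.
Implicit Types (f g h a b : R -> R) (p q r : ring_pair R).

Lemma regular_Cm1 b : regular b -> Cm1 b. Proof. by case. Qed.
#[local] Hint Resolve regular_Cm1 : core.

(** If b vanished on (0,+oo), it would annihilate the constant 1, and cancellation would give 1 =
    0. *)
Lemma is_fraction_regular a b : Cm1 a -> regular b -> is_fraction (a, b).
Proof.
move=> ha rb; split => //=; first exact: regular_Cm1.
apply: contrapT => nb; have b0 t : 0 < t -> b t = 0.
  by move=> t0; apply/eqP; apply: contrapT => /negP bt; apply: nb; exists t.
have h1 : Cm1 (fun _ : R => 1 : R) by exact: Cm1_cst.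
have : emb (fun _ : R => 1 : R) = emb (fun=> 0).
  rewrite (_ : emb (fun=> 0) = 0); last first.
    apply: unitization_eq; first by rewrite uval1_emb.
    move=> t; rewrite uval_emb; last exact: Cm1_cst.
    by rewrite /= /causal; case: ifP.
  have [_ rb'] := rb; apply: rb' => //.
  have [_ r1] := @regular_one R.
  rewrite -embM//; last by case: rb.
  apply: unitization_eq; first by rewrite uval1_emb.
  move=> t; rewrite uval_emb; last by apply: Cm1_conv => //; case: rb.
  rewrite /= causal_conv (@conv_eq _ b (fun=> 0) (fun=> 1) (fun=> 1))//.
  exact: conv0l.
move=> /(emb_inj h1 (Cm1_cst 0))/(_ 1 ltr01)/eqP; by rewrite oner_eq0.
Qed.

Lemma frac_equivP p q : Cm1 p.1 -> Cm1 p.2 -> Cm1 q.1 -> Cm1 q.2 ->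
  frac_equiv p q <-> emb p.1 * emb q.2 = emb q.1 * emb p.2.
Proof.
move=> p1 p2 q1 q2; rewrite -!embM//; split; first exact: emb_ext.
by move=> /emb_inj; apply; exact: Cm1_conv.
Qed.

Lemma frac_self a b : Cm1 a -> regular b -> frac a b (a, b).
Proof. by move=> ha rb; split => //; exact: is_fraction_regular. Qed.

Lemma fracP a b p : Cm1 a -> regular b -> frac a b p ->
  is_fraction p /\ emb p.1 * emb b = emb a * emb p.2.
Proof.
move=> ha [hb _] [fp /frac_equivP e]; split => //.
by case: fp => h1 h2 _; exact: e.
Qed.

(** Transitivity of the equivalence through (a, b): the factor cancelled is the denominator of the
    middle fraction. *)
Lemma frac_eq a b a' b' : Cm1 a -> regular b -> Cm1 a' -> regular b' ->
  emb a * emb b' = emb a' * emb b -> frac a b = frac a' b'.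
Proof.
move=> ha rb ha' rb' e.
wlog suff H : a b a' b' ha rb ha' rb' e / frac a b `<=` frac a' b'.
  by apply/seteqP; split; apply: H.
move=> r /(fracP ha rb)[fr re]; split => //.
have [r1 r2 _] := fr; have [hb hb'] := (regular_Cm1 rb, regular_Cm1 rb').
apply/frac_equivP => //=; apply: (regular_cancel rb); rewrite ?uval1E//.
transitivity (emb r.1 * emb b * emb b'); first by ring.
rewrite re; transitivity (emb a * emb b' * emb r.2); first by ring.
by rewrite e; ring.
Qed.

Lemma zeroF_frac b : regular b -> zeroF = frac (fun=> 0) b.
Proof.
move=> rb; have hb := regular_Cm1 rb; apply/seteqP; split => r.
  move=> [fr r0]; split => // t t0; have [r1 r2 _] := fr.
  by rewrite /= (@conv_eq _ r.1 (fun=> 0) b b)// !conv0l.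
move=> [fr re]; split => //; have [r1 r2 _] := fr => t t0.
have e : emb b * emb r.1 = 0.
  rewrite mulrC -embM//; apply: unitization_eq; first by rewrite uval1_emb.
  move=> s; rewrite uval_emb; last exact: Cm1_conv.
  by rewrite /= /causal; case: ifP => // s0; rewrite re//= conv0l.
case: rb => _ /(_ _ r1 e) /(congr1 (fun x => (uval x).2 t)).
by rewrite uval_emb//= causal_pos.
Qed.

Lemma oneF_frac b : regular b -> oneF = frac b b.
Proof.
move=> rb; have hb := regular_Cm1 rb; apply/seteqP; split => r.
  move=> [fr r0]; split => //; have [r1 r2 _] := fr.
  by apply/frac_equivP => //=; rewrite (emb_ext r0) mulrC.
move=> /(fracP hb rb) [fr re]; split => //; have [r1 r2 _] := fr.
apply: emb_inj => //; apply: (regular_cancel rb); rewrite ?uval1E//.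
by rewrite -re mulrC.
Qed.

(** One inclusion specializes the quantified representatives to the given ones. The other proves
    independence of the choice by multiplying through by b * b' and cancelling it. The other
    operations follow the same pattern. *)
Lemma mulF_frac a b a' b' : Cm1 a -> regular b -> Cm1 a' -> regular b' ->
  mulF (frac a b) (frac a' b') = frac (conv a a') (conv b b').
Proof.
move=> ha rb ha' rb'; have [hb hb'] := (regular_Cm1 rb, regular_Cm1 rb').
have rbb := regular_conv rb rb'.
apply/seteqP; split => r.
  by move=> [fr /(_ _ _ (frac_self ha rb) (frac_self ha' rb'))].
move=> /(fracP (Cm1_conv ha ha') rbb)[fr re]; split => // p q.
have [r1 r2 _] := fr.
move=> /(fracP ha rb)[[p1 p2 _] pe] /(fracP ha' rb')[[q1 q2 _] qe].
apply/frac_equivP => //=; try exact: Cm1_conv.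
apply: (regular_cancel rbb); rewrite ?uval1E//.
rewrite !embM// in re *.
transitivity (emb r.1 * (emb b * emb b') * (emb p.2 * emb q.2)); first by ring.
rewrite re.
transitivity (emb a * emb p.2 * (emb a' * emb q.2) * emb r.2); first by ring.
by rewrite -pe -qe; ring.
Qed.

Lemma addF_frac a b a' b' : Cm1 a -> regular b -> Cm1 a' -> regular b' ->
  addF (frac a b) (frac a' b') =
  frac (fun t => conv a b' t + conv a' b t) (conv b b').
Proof.
move=> ha rb ha' rb'; have [hb hb'] := (regular_Cm1 rb, regular_Cm1 rb').
have rbb := regular_conv rb rb'.
have hs (u v w z : R -> R) : Cm1 u -> Cm1 v -> Cm1 w -> Cm1 z ->
    Cm1 (fun t => conv u v t + conv w z t).
  by move=> *; apply: Cm1D; exact: Cm1_conv.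
apply/seteqP; split => r.
  by move=> [fr /(_ _ _ (frac_self ha rb) (frac_self ha' rb'))].
move=> /(fracP (hs _ _ _ _ ha hb' ha' hb) rbb)[fr re]; split => // p q.
have [r1 r2 _] := fr.
move=> /(fracP ha rb)[[p1 p2 _] pe] /(fracP ha' rb')[[q1 q2 _] qe].
apply/frac_equivP => //=; [exact: hs|exact: Cm1_conv|].
apply: (regular_cancel rbb); rewrite ?uval1E//.
rewrite !embD ?embM// in re *; try exact: Cm1_conv.
transitivity (emb r.1 * (emb b * emb b') * (emb p.2 * emb q.2)); first by ring.
rewrite re.
transitivity ((emb a * emb p.2 * emb b' * emb q.2 +
  emb a' * emb q.2 * emb b * emb p.2) * emb r.2); first by ring.
by rewrite -pe -qe; ring.
Qed.

Lemma scaleF_frac c a b : Cm1 a -> regular b ->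
  scaleF c (frac a b) = frac (fun t => c * a t) b.
Proof.
move=> ha rb; have hb := regular_Cm1 rb; apply/seteqP; split => r.
  by move=> [fr /(_ _ (frac_self ha rb))].
move=> /(fracP (Cm1Z c ha) rb)[fr re]; split => // p.
have [r1 r2 _] := fr; move=> /(fracP ha rb)[[p1 p2 _] pe].
apply/frac_equivP => //=; first exact: Cm1Z.
apply: (regular_cancel rb); rewrite ?uval1E//.
rewrite !embZ// in re *.
transitivity (emb r.1 * emb b * emb p.2); first by ring.
rewrite re; transitivity (uscal c * (emb a * emb p.2) * emb r.2); first by ring.
by rewrite -pe; ring.
Qed.

End fractions.

(** * Sequential derivatives *)

Section sequential_derivative.
Context {R : realType}.
Variables (kappa k1 k2 : R -> R) (n : nat) (f : R -> R).
Hypotheses (hL : L11 kappa k1 k2) (hn : (0 < n)%N) (hf : Cm1_space k1 k2 n.-1 f).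

Let hkappa : Cm1 kappa. Proof. by case: hL. Qed.
Let hk1 : Cm1 k1. Proof. by case: hL. Qed.
Let hk2 : Cm1 k2. Proof. by case: hL. Qed.
#[local] Hint Resolve hkappa hk1 hk2 : core.

Let one_eq : emb kappa * emb k1 * emb k2 = emb (fun=> 1).
Proof.
rewrite -!embM//; last exact: Cm1_conv.
by case: hL => _ _ _ /emb_ext.
Qed.

Let regular_kappa : regular kappa.
Proof. by apply: (@regular_dvd_one _ _ (emb k1 * emb k2)) => //; rewrite mulrA. Qed.

Let regular_k2 : regular k2.
Proof.
by apply: (@regular_dvd_one _ _ (emb kappa * emb k1)) => //; rewrite mulrC.
Qed.

Lemma Cm1_conv_pow m : Cm1 (conv_pow kappa m).
Proof. by case: m => [//|]; elim=> [//|m IH]; apply: Cm1_conv. Qed.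

(** The index starts at 1, since [conv_pow kappa 0] is [kappa] and not a unit. *)
Lemma emb_conv_pow m : emb (conv_pow kappa m.+1) = emb kappa ^+ m.+1.
Proof.
elim: m => [|m IH]; first by rewrite expr1.
have -> : conv_pow kappa m.+2 = conv kappa (conv_pow kappa m.+1) by [].
by rewrite embM// ?IH ?exprS//; exact: Cm1_conv_pow.
Qed.

Lemma regular_conv_pow m : regular (conv_pow kappa m).
Proof. by case: m => [//|]; elim=> [//|m IH]; apply: regular_conv. Qed.

(** The extra kappa above and below covers m = 0 as well, where the unity has to be written as kappa
    / kappa. *)
Lemma powF_SF m : powF (SF kappa) m = frac kappa (conv_pow kappa m.+1).
Proof.
elim: m => [|m IH]; first exact: oneF_frac.
transitivity (mulF (SF kappa) (powF (SF kappa) m)); first by [].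
rewrite IH /SF mulF_frac//; try exact: regular_conv_pow.
apply: frac_eq; rewrite ?embM ?emb_conv_pow//; try exact: regular_conv_pow;
  try exact: Cm1_conv_pow; try exact: Cm1_conv.
- by apply: regular_conv; exact: regular_conv_pow.
- by rewrite !exprS; ring.
- exact: (Cm1_conv_pow m.+1).
Qed.

Lemma mulF_SF_emb m g : Cm1 g ->
  mulF (powF (SF kappa) m) (embF kappa g) =
  frac (conv g kappa) (conv_pow kappa m.+1).
Proof.
move=> hg; rewrite powF_SF /embF mulF_frac//;
  [|exact: regular_conv_pow|exact: Cm1_conv].
apply: frac_eq; rewrite ?embM ?emb_conv_pow//; try exact: regular_conv_pow;
  try exact: Cm1_conv_pow; try by repeat apply: Cm1_conv.
- by apply: regular_conv => //; exact: regular_conv_pow.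
- by ring.
Qed.

Local Notation g_ j := (GFD1_seq k1 k2 j f).
Local Notation c_ j := (GFI0 k2 (g_ j)).

Let hfj j : (j < n)%N -> [/\ Cm1 (g_ j), GFD_exists k2 (g_ j) & Cm1 (GFD k2 (g_ j))].
Proof. by move=> jn; apply: hf; rewrite -ltnS prednK. Qed.

(** The hypothesis on f stops at n - 1; the last function is the convolution of k1 with a function
    of C_{-1}. *)
Lemma Cm1_GFD1_seq j : (j <= n)%N -> Cm1 (g_ j).
Proof.
case: j => [_|j jn]; first by case: (hfj hn).
by have [_ _ hD] := hfj jn; exact: Cm1_conv.
Qed.

Lemma GFD1_seq_existsP : GFD1_seq_exists k1 k2 n f.
Proof.
move=> j jn; have [h1 h2 h3] := hfj jn; split => // t t0.
exact: conv_existsP.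
Qed.

(* [k2 * g = c 1 + 1 * (k2 * g)'] with [1 = kappa * k1 * k2]; then cancel [k2]. *)
Lemma emb_GFD1_seq j : (j < n)%N ->
  emb (g_ j) = uscal (c_ j) * (emb kappa * emb k1) + emb kappa * emb (g_ j.+1).
Proof.
move=> jn; have [h1 h2 h3] := hfj jn.
apply: (regular_cancel regular_k2); rewrite ?uval1E//.
have -> : emb (g_ j.+1) = emb k1 * emb (GFD k2 (g_ j)) by rewrite -embM.
have hone : Cm1 (fun _ : R => 1 : R) by exact: Cm1_cst.
have -> : emb k2 * emb (g_ j) =
    emb (fun t => c_ j * 1 + conv (fun=> 1) (GFD k2 (g_ j)) t).
  rewrite -embM//; apply: emb_ext => t t0; rewrite mulr1.
  apply: primitive_conv1 => // s s0; split => //.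
  by have [] := h2 s s0.
rewrite embD; [|exact: Cm1Z|exact: Cm1_conv].
by rewrite embZ// embM// -one_eq; ring.
Qed.

Lemma Cm1_P1L m : Cm1 (P1L kappa k1 k2 m f).
Proof.
elim: m => [|m IH].
  have -> : P1L kappa k1 k2 0 f = fun=> 0 by apply/funext => t; rewrite /P1L big_ord0.
  exact: Cm1_cst.
have -> : P1L kappa k1 k2 m.+1 f = P1L kappa k1 k2 m f \+
    (fun t => c_ m * conv (conv_pow kappa m.+1) k1 t).
  by apply/funext => t; rewrite /P1L big_ord_recr.
by apply: Cm1D => //; apply: Cm1Z; apply: Cm1_conv => //; exact: Cm1_conv_pow.
Qed.

(** A Taylor expansion with remainder: expanding g_m by [emb_GFD1_seq] splits off the next term of
    [P1L] and leaves the next remainder. At m = 0 the power kappa^0 is the adjoined unit. *)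
Lemma emb_decomposition m : (m <= n)%N ->
  emb f = emb (P1L kappa k1 k2 m f) + emb kappa ^+ m * emb (g_ m).
Proof.
elim: m => [_|m IH mn].
  have -> : emb (P1L kappa k1 k2 0 f) = 0.
    apply: unitization_eq; first by rewrite uval1_emb.
    move=> t; rewrite uval_emb; last exact: Cm1_P1L.
    by rewrite /= /causal /P1L big_ord0; case: ifP.
  by rewrite add0r expr0 mul1r.
rewrite (IH (ltnW mn)) emb_GFD1_seq//.
have -> : emb (P1L kappa k1 k2 m.+1 f) =
    emb (fun t => P1L kappa k1 k2 m f t + c_ m * conv (conv_pow kappa m.+1) k1 t).
  by apply: emb_ext => t _; rewrite /P1L big_ord_recr.
have hc : Cm1 (conv (conv_pow kappa m.+1) k1).
  by apply: Cm1_conv => //; exact: Cm1_conv_pow.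
rewrite embD; [|exact: Cm1_P1L|exact: Cm1Z].
rewrite embZ// embM// ?emb_conv_pow; last exact: Cm1_conv_pow.
by rewrite exprSr; ring.
Qed.

Lemma AGFD1E : embF kappa (g_ n) = AGFD1 kappa k1 k2 n f.
Proof.
have hP := Cm1_P1L n; have hg := Cm1_GFD1_seq (leqnn n).
have hf0 : Cm1 f := Cm1_GFD1_seq (leq0n n).
rewrite /AGFD1 !mulF_SF_emb// /subF scaleF_frac;
  [|exact: Cm1_conv|exact: regular_conv_pow].
rewrite addF_frac; [|exact: Cm1_conv|exact: regular_conv_pow
  |apply: Cm1Z; exact: Cm1_conv|exact: regular_conv_pow].
have rc := regular_conv_pow n.+1; have hc := Cm1_conv_pow n.+1.
apply: frac_eq => //; first exact: Cm1_conv.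
- by apply: Cm1D; apply: Cm1_conv => //; [|apply: Cm1Z]; exact: Cm1_conv.
- exact: regular_conv.
rewrite embD; [|by apply: Cm1_conv => //; exact: Cm1_conv
  |by apply: Cm1_conv => //; apply: Cm1Z; exact: Cm1_conv].
rewrite !embM//; try (apply: Cm1Z; exact: Cm1_conv); try exact: Cm1_conv.
rewrite embZ ?embM//; last exact: Cm1_conv.
rewrite emb_conv_pow (emb_decomposition (leqnn n)).
(* With the scalar -1 read as the ring element -1, the two copies of [P1L] cancel by [ring]. *)
have -> : uscal (-1) = -1 :> unitization (R := R).
  by apply: unitization_eq => // t; rewrite -[RHS]/(- 0) oppr0.
by rewrite exprS; ring.
Qed.

(** All terms are brought over the denominator kappa^{<n+1>}: cancelling kappa^{<j+1>} in the j-th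
    one leaves kappa^{<n-j>}, the denominator of S_kappa^{n-j-1}. *)
Lemma mulF_SF_P1L :
  mulF (powF (SF kappa) n) (embF kappa (P1L kappa k1 k2 n f)) =
  \big[addF/zeroF]_(j < n)
    scaleF (c_ j) (mulF (powF (SF kappa) (n - j - 1)) (embF kappa k1)).
Proof.
have rc := regular_conv_pow n.+1; have hc := Cm1_conv_pow n.+1.
rewrite mulF_SF_emb; last exact: Cm1_P1L.
have -> : P1L kappa k1 k2 n f =
    \sum_(j < n) (fun t => c_ j * conv (conv_pow kappa j.+1) k1 t).
  by apply/funext => t; rewrite /P1L fct_sumE.
(* Relates partial sums of classes to partial sums of numerators, and carries the membership in
   C_{-1} that [addF_frac] needs at each addition. *)
pose K (c : quotients R) (a : R -> R) :=
  Cm1 a /\ c = frac (conv a kappa) (conv_pow kappa n.+1).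
suff [_ <-//] : K (\big[addF/zeroF]_(j < n) scaleF (c_ j)
      (mulF (powF (SF kappa) (n - j - 1)) (embF kappa k1)))
    (\sum_(j < n) (fun t => c_ j * conv (conv_pow kappa j.+1) k1 t)).
apply: (big_ind2 K).
- split; first exact: (Cm1_cst 0).
  rewrite (zeroF_frac rc); congr frac.
  by apply/funext => t; rewrite -[RHS]/(conv (fun=> 0) kappa t) conv0l.
- move=> c a d b [ha ->] [hb ->]; split; first exact: Cm1D.
  have hab : Cm1 (a + b) by exact: Cm1D.
  rewrite addF_frac//; try exact: Cm1_conv.
  apply: frac_eq => //; try exact: Cm1_conv.
  + by apply: Cm1D; apply: Cm1_conv => //; exact: Cm1_conv.
  + exact: regular_conv.
  rewrite embD; [|by apply: Cm1_conv => //; exact: Cm1_conv..].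
  rewrite !embM//; try exact: Cm1_conv.
  by rewrite -[emb (a + b)]/(emb (fun t => a t + b t)) embD//; ring.
- move=> j _.
  have hj : Cm1 (conv (conv_pow kappa j.+1) k1).
    by apply: Cm1_conv => //; exact: Cm1_conv_pow.
  have hcj := Cm1Z (c_ j) hj.
  split => //.
  have rj := regular_conv_pow (n - j - 1).+1.
  rewrite mulF_SF_emb// scaleF_frac//; last exact: Cm1_conv.
  apply: frac_eq => //; [by apply: Cm1Z; exact: Cm1_conv|exact: Cm1_conv|].
  rewrite embZ; last exact: Cm1_conv.
  rewrite !embM// embZ// embM//; last exact: Cm1_conv_pow.
  rewrite !emb_conv_pow.
  (* The subtraction is truncated; the exponents add up because j < n. *)
  have -> : emb kappa ^+ n.+1 = emb kappa ^+ (n - j - 1).+1 * emb kappa ^+ j.+1.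
    by rewrite -exprD; congr (_ ^+ _); have := ltn_ord j; lia.
  by ring.
Qed.

End sequential_derivative.

Unset Implicit Arguments.

(** The operators are total, so existence in the usual sense is a clause of its own: at each stage
    the integrals converge and the derivative exists. Membership in C_{-1} is what allows the last
    derivative to be read in the field. *)
Theorem theorem6 (R : realType) (kappa k1 k2 : R -> R) (n : nat) (f : R -> R)
    (hL : L11 kappa k1 k2) (hn : (0 < n)%N) (hf : Cm1_space k1 k2 n.-1 f) :
  [/\ GFD1_seq_exists k1 k2 n f,
      Cm1 (GFD1_seq k1 k2 n f),
      embF kappa (GFD1_seq k1 k2 n f) = AGFD1 kappa k1 k2 n f
    & AGFD1 kappa k1 k2 n f =
        subF (mulF (powF (SF kappa) n) (embF kappa f))
          (\big[addF/zeroF]_(j < n)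
             scaleF (GFI0 k2 (GFD1_seq k1 k2 j f))
               (mulF (powF (SF kappa) (n - j - 1)) (embF kappa k1)))].
Proof.
split.
- exact: (GFD1_seq_existsP hL hn hf).
- exact: (Cm1_GFD1_seq hL hn hf (leqnn n)).
- exact: (AGFD1E hL hn hf).
- by rewrite /AGFD1 (mulF_SF_P1L f hL).
Qed.
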